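(* Let $q$ be an odd prime power, $p$ the characteristic of $\mathbb{F}_q$, and $k$ an integer. Assume that $3\le k+1\le p$ or $3\le q-p+1\le k+1\le q-2$. Then the covering radius of the projective Reed-Solomon code $PRS(q+1,k)$ over $\mathbb{F}_q$ is $q-k$, and for every polynomial $f\in\mathbb{F}_q[x]$ with $\deg(f)=k$ and every $v\in\mathbb{F}_q$, the word $(u_f,v)\in\mathbb{F}_q^{q+1}$ is a deep hole of $PRS(q+1,k)$.
   Context: Write $\mathbb{F}_q=\{\alpha_1,\dots,\alpha_q\}$. For a polynomial $f\in\mathbb{F}_q[x]$ of degree at most $q-1$, put $u_f=(f(\alpha_1),\dots,f(\alpha_q))\in\mathbb{F}_q^q$; for $v\in\mathbb{F}_q$, $(u_f,v)\in\mathbb{F}_q^{q+1}$ is $u_f$ with $v$ appended as last coordinate. The projective Reed-Solomon code is $PRS(q+1,k)=\{(u_f,c_{k-1}(f)) : f\in\mathbb{F}_q[x],\ \deg f\le k-1\}\subseteq \mathbb{F}_q^{q+1}$, where $c_{k-1}(f)$ is the coefficient of $x^{k-1}$ in $f$. For a linear code $C\subseteq\mathbb{F}_q^n$ and $u\in\mathbb{F}_q^n$, $d(u,C)$ is the minimum Hamming distance from $u$ to a codeword of $C$; the covering radius is $\rho(C)=\max\{d(u,C): u\in\mathbb{F}_q^n\}$; a word $u$ is a deep hole of $C$ if $d(u,C)=\rho(C)$. *)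

(* Defs.v *)
From mathcomp Require Import all_boot all_order all_algebra.

Set Implicit Arguments.
Unset Strict Implicit.
Unset Printing Implicit Defensive.

Import GRing.Theory.
Local Open Scope ring_scope.

Definition hamming_dist (F : finFieldType) (n : nat) (u w : 'rV[F]_n) : nat :=
  #|[set i : 'I_n | u 0 i != w 0 i]|.

(* The neutral element n bounds every Hamming distance, so for a nonempty C
   this is exactly the minimum. *)
Definition dist_to_code (F : finFieldType) (n : nat)
    (u : 'rV[F]_n) (C : {set 'rV[F]_n}) : nat :=
  \big[minn/n]_(c in C) hamming_dist u c.

Definition covering_radius (F : finFieldType) (n : nat)
    (C : {set 'rV[F]_n}) : nat :=
  \max_(u : 'rV[F]_n) dist_to_code u C.

Definition deep_hole (F : finFieldType) (n : nat)
    (u : 'rV[F]_n) (C : {set 'rV[F]_n}) : Prop :=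
  dist_to_code u C = covering_radius C.

Section ProjectiveReedSolomon.

Variables (F : finFieldType) (q : nat) (alpha : 'I_q -> F).

Definition eval_word (f : {poly F}) : 'rV[F]_q := \row_i f.[alpha i].

Definition ext_word (f : {poly F}) (v : F) : 'rV[F]_(q + 1) :=
  row_mx (eval_word f) (const_mx v).

(* {poly_k F} consists of the polynomials of size at most k, that is, of
   degree at most k - 1. *)
Definition PRS (k : nat) : {set 'rV[F]_(q + 1)} :=
  [set ext_word (f : {poly F}) (f : {poly F})`_(k.-1) | f : {poly_k F}].

End ProjectiveReedSolomon.

(* Main.v *)
Require Import Defs.
From HB Require Import structures.
From mathcomp Require Import all_boot all_order all_fingroup all_algebra.
From mathcomp Require Import cyclic finfield.
From mathcomp Require Import zify ring.

(* Put m = q - k and, for a word (u, v), L(h) = sum_x u(x) h(x) + v h_m on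
   polynomials h of degree at most m. The code is annihilated by these forms, so
   (u, v) is within distance m of the code as soon as L kills the monic
   polynomial with root set X for some X of size m or m - 1 (size m - 1
   corresponds to the point at infinity). Suppose L kills none of them.

   If 2m <= q + 1: for Y of size m - 2, L(prod_Y ('X - y) * -) restricted to
   degree at most 2 is a symmetric bilinear form on the projective line. If it
   is nondegenerate, it defines an involution which sends every x outside Y to
   itself or into Y, which the count forbids; so it is degenerate, with kernel
   some a in Y. Descending on #|Y|, for every Y of size m - j some a in Y makes
   L vanish on all multiples of prod_Y ('X - y) * ('X - a) of degree at most m;
   Y = set0 is absurd.

   If k < p and 2k - 1 <= q: let phi(C) be the value of L at the polynomial with
   root set the complement of C. This is the arc situation of the MDS
   conjecture, and Ball's argument applies: Segre's lemma of tangents follows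
   from the product of all nonzero elements of F being -1, and together with
   Lagrange interpolation it gives a nowhere zero weight on the k-subsets of a
   set G of size 2k - 1 whose sum over the k-subsets containing any given
   (k-1)-subset is 0. Since k < p, the inclusion matrix of (k-1)-subsets versus
   k-subsets of G is invertible in characteristic p, a contradiction. *)

Set Implicit Arguments.
Unset Strict Implicit.
Unset Printing Implicit Defensive.

Import GRing.Theory.
Local Open Scope ring_scope.

(** * Polynomials with prescribed roots, Lagrange interpolation, and sums over a finite field *)

Section NodePolynomials.

Variable F : finFieldType.
Implicit Types (X E : {set F}) (x : F) (P : {poly F}).

Definition node_poly X : {poly F} := \prod_(x in X) ('X - x%:P).

Lemma node_polyU1 x X : x \notin X ->
  node_poly (x |: X) = ('X - x%:P) * node_poly X.
Proof. exact: big_setU1. Qed.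

Lemma size_node_poly X : size (node_poly X) = #|X|.+1.
Proof. by rewrite /node_poly -big_enum size_prod_XsubC cardE. Qed.

Lemma monic_node_poly X : node_poly X \is monic.
Proof. by rewrite /node_poly -big_enum monic_prod_XsubC. Qed.

Lemma lead_node_poly X : (node_poly X)`_#|X| = 1.
Proof. by rewrite -(monicP (monic_node_poly X)) lead_coefE size_node_poly. Qed.

Lemma node_poly_neq0 X x : x \notin X -> (node_poly X).[x] != 0.
Proof.
move=> xX; rewrite horner_prod; apply/prodf_neq0 => y yX.
by rewrite hornerXsubC subr_eq0; apply: contraNneq xX => ->.
Qed.

Lemma node_poly_root X x : x \in X -> (node_poly X).[x] = 0.
Proof.
by move=> xX; rewrite /node_poly (bigD1 x) //= hornerM hornerXsubC subrr mul0r.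
Qed.

Lemma poly_eq0_on_set X P :
  (size P <= #|X|)%N -> {in X, forall x, P.[x] = 0} -> P = 0.
Proof.
move=> sP PX; apply: (@roots_geq_poly_eq0 _ _ (enum X)).
- by apply/allP => x; rewrite mem_enum => /PX/eqP.
- exact: enum_uniq.
- by rewrite -cardE.
Qed.

Lemma quadratic_eq0_on_set X (a b c : F) : (2 < #|X|)%N ->
  {in X, forall x, a * x ^+ 2 + b * x + c = 0} -> [/\ a = 0, b = 0 & c = 0].
Proof.
move=> cX HX; have E : a%:P * 'X^2 + b%:P * 'X + c%:P = 0 :> {poly F}.
  apply: (@poly_eq0_on_set X) => [|x xX]; last
    by rewrite !(hornerD, hornerM, hornerC, hornerX, hornerXn) HX.
  apply: leq_trans cX; apply: leq_trans (size_polyD _ _) _.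
  rewrite geq_max; apply/andP; split; last first.
    by rewrite (leq_trans (size_polyC_leq1 _)).
  apply: leq_trans (size_polyD _ _) _.
  rewrite !mul_polyC geq_max !(leq_trans (size_scale_leq _ _)) ?size_polyXn //.
  by rewrite size_polyX.
have coefE i : (a%:P * 'X^2 + b%:P * 'X + c%:P)`_i = 0 by rewrite E coef0.
move: (coefE 0%N) (coefE 1%N) (coefE 2%N).
rewrite !coefD !coefCM !coefXn !coefX !coefC /= !mulr0 !mulr1 ?addr0 ?add0r.
by move=> -> -> ->.
Qed.

(** The nodes are the values of an injective map [g], because later they are values of a linear form
    as well as plain field elements. *)
Lemma lagrange_interpolation E (g r : F -> F) : {in E &, injective g} ->
  exists2 P : {poly F}, (size P <= #|E|)%N &
    {in E, forall e, P.[g e] = r e} /\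
    P`_(#|E|.-1) = \sum_(e in E) r e / \prod_(z in E :\ e) (g e - g z).
Proof.
move=> injg; pose d e := \prod_(z in E :\ e) (g e - g z).
pose B e : {poly F} := \prod_(z in E :\ e) ('X - (g z)%:P).
have sB e : e \in E -> size (B e) = #|E|.
  by move=> eE; rewrite /B -big_enum size_prod_XsubC -cardE (cardsD1 e E) eE.
exists (\sum_(e in E) (r e / d e) *: B e).
  apply: leq_trans (size_sum _ _ _) _; apply/bigmax_leqP => e eE.
  by rewrite (leq_trans (size_scale_leq _ _)) ?sB.
split=> [e eE|].
  rewrite horner_sum (bigD1 e) //= big1 ?addr0 => [|z /andP[zE nze]].
    rewrite hornerZ horner_prod -/(d e) (eq_bigr (fun z => g e - g z)).
      rewrite divfK //; apply/prodf_neq0 => z /setD1P[nze zE].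
      by rewrite subr_eq0; apply: contraNneq nze => /injg->.
    by move=> z _; rewrite hornerXsubC.
  rewrite hornerZ horner_prod (bigD1 e) /=; last by rewrite !inE eq_sym nze.
  by rewrite hornerXsubC subrr mul0r mulr0.
rewrite coef_sum; apply: eq_bigr => e eE.
rewrite coefZ -{1}(sB e eE) -lead_coefE.
by rewrite /B -big_enum (monicP (monic_prod_XsubC _ _ _)) mulr1.
Qed.

Lemma lagrange_coef E (g : F -> F) P : {in E &, injective g} ->
  (size P <= #|E|)%N ->
  P`_(#|E|.-1) = \sum_(e in E) P.[g e] / \prod_(z in E :\ e) (g e - g z).
Proof.
move=> injg sP.
have [Q sQ [QE <-]] := lagrange_interpolation (fun e => P.[g e]) injg.
suff -> : P = Q by [].
apply/eqP; rewrite -subr_eq0; apply/eqP/(@poly_eq0_on_set (g @: E)).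
  rewrite card_in_imset //; apply: leq_trans (size_polyD _ _) _.
  by rewrite size_polyN geq_max sP.
by move=> _ /imsetP[e eE ->]; rewrite !hornerE QE // subrr.
Qed.

Lemma natr_card_finField : #|F|%:R = 0 :> F.
Proof. by rewrite -FinRing.zmodXgE -cardsT expg_cardG ?inE. Qed.

(** Differentiate ['X^q - 'X = \prod_y ('X - y)], with [q] the order of the field, and evaluate at
    [x]: the term carrying the factor [q] vanishes. *)
Lemma prod_sub_others x : \prod_(y | y != x) (x - y) = -1 :> F.
Proof.
have := congr1 (fun P => (P^`()).[x]) (finField_genPoly F).
rewrite (bigD1 x) //= derivB derivXn derivX derivM derivXsubC mul1r.
rewrite !hornerE subrr mul0r addr0 hornerMn -mulr_natr.
rewrite natr_card_finField mulr0 add0r.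
by rewrite horner_prod => ->; apply: eq_bigr => y _; rewrite hornerXsubC.
Qed.

(** Lagrange's formula for the top coefficient with all of [F] as nodes: every denominator is
    [-1]. *)
Lemma sum_horner P : (size P <= #|F|)%N ->
  \sum_(x : F) P.[x] = - P`_(#|F|.-1).
Proof.
move=> sP; have := @lagrange_coef [set: F] id P (in2W (@inj_id _)).
rewrite cardsT => /(_ sP) ->; rewrite -sumrN.
apply: eq_big => [x|x _]; first by rewrite inE.
rewrite (_ : \prod_(z in _) _ = -1) ?invrN1 ?mulrN1 ?opprK //.
by rewrite -(prod_sub_others x); apply: eq_bigl => y; rewrite !inE andbT.
Qed.

End NodePolynomials.

(** * Inclusion matrices of subsets *)

(* [S i] sums [beta] over the [k]-subsets meeting [C0] in [i] points; double
   counting gives [(k - i) S i + (i + 1) S (i + 1) = 0], and [S 0 = 0] because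
   [G] is too small. *)
Lemma inclusion_kernel (F : fieldType) (T : finType) (G C0 : {set T}) (k : nat)
    (beta : {set T} -> F) :
  (#|G| < k.*2)%N -> (forall i, (0 < i <= k)%N -> i%:R != 0 :> F) ->
  (forall S : {set T}, S \subset G -> #|S| = k.-1 ->
     \sum_(e in G :\: S) beta (e |: S) = 0) ->
  C0 \subset G -> #|C0| = k -> beta C0 = 0.
Proof.
move=> cG char beta0 C0G cC0.
pose ksub (C : {set T}) := (C \subset G) && (#|C| == k).
pose S i := \sum_(C | ksub C && (#|C :&: C0| == i)) beta C.
have k_gt0 : (0 < k)%N by case: (k) cG; rewrite ?ltn0.
have rec i : (i < k)%N -> S i *+ (k - i) + S i.+1 *+ i.+1 = 0.
  move=> ltik.
  (* Sum over pairs [e \in C] such that [C :\ e] meets [C0] in [i] points. Grouped by [C :\ e] the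
     sum is 0 by hypothesis; grouped by [C] it gives the recursion, according to whether [e] lies in
     [C0]. *)
  pose w C e := if #|(C :\ e) :&: C0| == i then beta C else 0.
  have E1 : \sum_(C | ksub C) \sum_(e in C) w C e = 0.
    rewrite (exchange_big_dep (mem G)) /=; last first.
      by move=> C e /andP[/subsetP CG _] /CG.
    transitivity (\sum_(e in G) \sum_(R : {set T} | [&& R \subset G,
        #|R| == k.-1, #|R :&: C0| == i & e \notin R]) beta (e |: R)).
      apply: eq_bigr => e eG.
      rewrite (reindex_onto (fun R => e |: R) (fun C => C :\ e)) /=; last first.
        by move=> C /andP[_ eC]; rewrite setD1K.
      rewrite (bigID (fun R : {set T} => #|R :&: C0| == i)) /= [X in _ + X]big1 ?addr0.
        apply: eq_big => [R|R /andP[/andP[_ /eqP RE] E]]; last by rewrite /w RE E.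
        rewrite /ksub setU11 andbT subUset sub1set eG /=.
        case: (boolP (e \in R)) => eR.
          rewrite !andbF (_ : _ == R = false) ?andbF //.
          by apply/negP => /eqP E; move: eR; rewrite -E setD11.
        rewrite cardsU1 eR setU1K // eqxx !andbT -andbA.
        by rewrite -{1}(prednK k_gt0).
      move=> R /andP[/andP[_ /eqP RE] /negPf E].
      by rewrite /w RE E.
    rewrite (exchange_big_dep (fun R : {set T} =>
      [&& R \subset G, #|R| == k.-1 & #|R :&: C0| == i])) /=; last first.
      by move=> e R _ /and4P[-> -> ->].
    apply: big1 => R /and3P[RG /eqP cR cRC0].
    rewrite -[RHS](beta0 R RG cR); apply: eq_bigl => e.
    by rewrite RG cR cRC0 eqxx /= inE andbC.
  rewrite -E1 /S -!sumrMnl !big_mkcondr -big_split /=.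
  apply: eq_bigr => C CG; case: eqP => cC; last by rewrite addr0.
  rewrite (bigID (mem C0)) /= [RHS]addrC; congr (_ + _).
    rewrite (eq_bigr (fun=> if #|C :&: C0| == i then beta C else 0)).
      rewrite sumr_const [X in _ = _ *+ X](_ : _ = (k - #|C :&: C0|)%N).
        by case: eqP => [->|]; rewrite ?mul0rn.
      by rewrite -cC -cardsD; apply: eq_card => e; rewrite !inE andbC.
    move=> e /andP[eC eC0]; rewrite /w; suff -> : (C :\ e) :&: C0 = C :&: C0 by [].
    apply/setP => z; rewrite !inE; case: eqP => // ->.
    by rewrite (negPf eC0) !andbF.
  rewrite (eq_bigr (fun=> if #|C :&: C0| == i.+1 then beta C else 0)).
    rewrite sumr_const [X in _ = _ *+ X](_ : _ = #|C :&: C0|).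
      by case: eqP => [->|]; rewrite ?mul0rn.
    by apply: eq_card => e; rewrite !inE.
  move=> e /andP[eC eC0]; rewrite /w setIDAC.
  by rewrite (cardsD1 e (C :&: C0)) inE eC eC0 add1n eqSS.
have S0 i : (i <= k)%N -> S i = 0.
  elim: i => [_|i IH ltik].
    rewrite /S big_pred0 // => C; apply/negP => /andP[/andP[CG /eqP cC]].
    rewrite cards_eq0 => /eqP CC0; have : (#|C :|: C0| <= #|G|)%N.
      by rewrite subset_leq_card // subUset CG.
    by rewrite cardsU CC0 cards0 cC cC0; lia.
  have := rec i ltik; rewrite IH ?(ltnW ltik) // mul0rn add0r -mulr_natr.
  by move/eqP; rewrite mulf_eq0 (negPf (char _ _)) ?orbF => [/eqP|].
(* [S k] has the single term [beta C0]. *)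
have := S0 k (leqnn k); rewrite /S (big_pred1 C0) // => C /=.
apply/andP/eqP => [[/andP[CG /eqP cC] /eqP cI]|->]; last first.
  by rewrite /ksub C0G cC0 setIid cC0 eqxx.
apply/eqP; rewrite eqEcard cC cC0 leqnn andbT.
by apply/setIidPl/eqP; rewrite eqEcard subsetIl cC cI leqnn.
Qed.

(** * Long codes: descent through degenerate symmetric forms *)

Section LongCodes.

Variables (F : finFieldType) (L : {scalar {poly F}}) (m : nat).
Hypothesis two_neq0 : 2%:R != 0 :> F.
Hypothesis m_gt0 : (0 < m)%N.
Hypothesis m_small : (m.*2 <= #|F|.+1)%N.
Hypothesis L_neq0 : forall X : {set F},
  (m.-1 <= #|X| <= m)%N -> L (node_poly X) != 0.

Implicit Types (X Y : {set F}) (h : {poly F}).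

Let LZ a h : L (a *: h) = a * L h. Proof. exact: scalarZ. Qed.

Lemma apolar_base Y : (#|Y| + 2 = m)%N ->
  exists2 a, a \in Y &
    forall h, (size h <= 2)%N -> L (node_poly Y * (('X - a%:P) * h)) = 0.
Proof.
move=> cY; set N := node_poly Y.
have eY : #|Y| = (m - 2)%N by lia.
(* Gram matrix entries of [(g, h) |-> L (N * g * h)] in the basis [1, 'X]; its determinant is
   [A * C - B ^+ 2]. *)
pose A := L N; pose B := L (N * 'X); pose C := L (N * 'X^2).
have cCY : (#|Y| + #|~: Y| = #|F|)%N by rewrite cardsC.
have lin_neq0 x : x \notin Y -> B - x * A != 0.
  move=> xY; have := @L_neq0 (x |: Y).
  rewrite cardsU1 xY node_polyU1 // (_ : _ * _ = N * 'X - x *: N); last first.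
    by rewrite -mul_polyC -/N; ring.
  rewrite linearB /= LZ; apply; rewrite eY; lia.
have quad_neq0 x y : x \notin Y -> y \notin Y -> x != y ->
    C - (x + y) * B + x * y * A != 0.
  move=> xY yY nxy; have := @L_neq0 (x |: (y |: Y)).
  rewrite !cardsU1 yY !inE (negPf xY) (negPf nxy) /= !node_polyU1 ?inE ?negb_or ?nxy //.
  rewrite (_ : _ * _ = N * 'X^2 - (x + y) *: (N * 'X) + (x * y) *: N); last first.
    by rewrite -!mul_polyC !polyCD !polyCM -/N; ring.
  rewrite linearD linearB /= !LZ; apply; rewrite eY; lia.
(* ['X - sigma x] is orthogonal to ['X - x]. By [lin_neq0] the point [sigma x] is never at infinity,
   and by [quad_neq0] it cannot be a point outside [Y] other than [x]. *)
pose sigma x := (C - x * B) / (B - x * A).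
have sigmaP x : x \notin Y -> C - (x + sigma x) * B + x * sigma x * A = 0.
  by move=> xY; rewrite /sigma; field; exact: lin_neq0.
have sigma_in x : x \notin Y -> sigma x != x -> sigma x \in Y.
  move=> xY nx; apply: contraTT nx => sY; rewrite negbK.
  apply: contraT; rewrite eq_sym => nx.
  by have := quad_neq0 x _ xY sY nx; rewrite sigmaP // eqxx.
have disc0 : A * C = B ^+ 2.
  apply/eqP; rewrite -subr_eq0; apply: contraT => disc.
  have injs : {in ~: Y &, injective sigma}.
    move=> x y; rewrite !inE => xY yY /eqP; rewrite eqr_div ?lin_neq0 // -subr_eq0.
    rewrite (_ : _ - _ = (A * C - B ^+ 2) * (x - y)); last by ring.
    by rewrite mulf_eq0 (negPf disc) subr_eq0 => /eqP.
  (* Fixed points are roots of the nonzero polynomial [A x^2 - 2 B x + C]. So at least [#|F| - m]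
     other points inject into [Y], which has [m - 2] elements, against [m_small]. *)
  pose Z := [set x in ~: Y | sigma x == x].
  have cZ : (#|Z| <= 2)%N.
    rewrite leqNgt; apply/negP => /(@quadratic_eq0_on_set _ Z A (- 2%:R * B) C)[].
      move=> x; rewrite !inE => /andP[xY /eqP sx].
      by have := sigmaP x xY; rewrite sx => <-; ring.
    move=> A0 /eqP; rewrite mulf_eq0 oppr_eq0 (negPf two_neq0) => /eqP B0 _.
    by move: disc; rewrite A0 B0; rewrite !(mul0r, expr0n) subrr eqxx.
  have : (#|sigma @: (~: Y :\: Z)| <= #|Y|)%N.
    apply/subset_leq_card/subsetP => _ /imsetP[x xYZ ->].
    by move: xYZ; rewrite !inE andbC => /andP[xY]; rewrite xY; apply: sigma_in.
  rewrite card_in_imset => [|x y /setDP[xY _] /setDP[yY _]]; last exact: injs.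
  have := cardsID Z (~: Y).
  have := subset_leq_card (subsetIr (~: Y) Z).
  lia.
have [x xY] : exists x, x \notin Y.
  have : (0 < #|~: Y|)%N by lia.
  by case/card_gt0P => x; rewrite inE; exists x.
have A0 : A != 0.
  apply: contraNneq (lin_neq0 x xY) => A0; move: disc0.
  by rewrite A0 mul0r mulr0 subr0 => /esym/eqP; rewrite expf_eq0.
(* The kernel of the degenerate form is spanned by ['X - B / A]. *)
exists (B / A) => [|h sh].
  apply: contraT => aY; have := lin_neq0 _ aY.
  by rewrite divfK // subrr eqxx.
have -> : h = (h`_1)%:P * 'X + (h`_0)%:P.
  apply/polyP => -[|[|i]]; rewrite coefD coefCM coefX coefC /=;
    rewrite ?mulr0 ?mulr1 ?addr0 ?add0r //.
  by rewrite nth_default // (leq_trans sh).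
set a := B / A.
rewrite (_ : N * _ = h`_1 *: (N * 'X^2) + (h`_0 - a * h`_1) *: (N * 'X)
    - (a * h`_0) *: N); last first.
  by rewrite -!mul_polyC !(polyCB, polyCM); ring.
rewrite linearB linearD /= !LZ -/A -/B -/C.
have -> : C = B ^+ 2 / A by rewrite -disc0 mulrC mulKf.
by rewrite /a; field.
Qed.

Lemma annihilates_shift (M : {poly F}) j : (0 < j)%N ->
  (forall h, (size h <= j)%N -> L (M * h) = 0 /\ L (M * ('X * h)) = 0) ->
  forall h, (size h <= j.+1)%N -> L (M * h) = 0.
Proof.
move=> j_gt0 HM h sh; rewrite -(poly_take_drop 1 h) expr1 mulrDr linearD /=.
have [-> _] := HM (take_poly 1 h) (leq_trans (size_take_poly _ _) j_gt0).
have [|_] := HM (drop_poly 1 h); first by rewrite size_drop_poly; lia.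
by rewrite [_ * 'X]mulrC add0r.
Qed.

(** Applying the assumption to [y |: Y] gives a point [c y] for each [y] outside [Y]. More than two
    fixed points of [c] would force [L] to kill a node polynomial; otherwise two points share a
    value of [c], and that value is the required [a]. *)
Lemma apolar_step j : (0 < j)%N ->
  (forall Y, (#|Y| + j = m)%N -> exists2 a, a \in Y &
    forall h, (size h <= j)%N -> L (node_poly Y * (('X - a%:P) * h)) = 0) ->
  (forall Y, (#|Y| + j.+1 = m)%N -> exists2 a, a \in Y &
    forall h, (size h <= j.+1)%N -> L (node_poly Y * (('X - a%:P) * h)) = 0).
Proof.
move=> j_gt0 IH Y cY; set N := node_poly Y.
have eY : #|Y| = (m - j.+1)%N by lia.
have cCY : (#|Y| + #|~: Y| = #|F|)%N by rewrite cardsC.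
(* The condition [y \notin Y] sits under the existential so that choice yields a total function; 0
   is a dummy value on [Y]. *)
have IH' y : exists a, y \notin Y -> a \in y |: Y /\
   forall h, (size h <= j)%N -> L (N * (('X - y%:P) * ('X - a%:P) * h)) = 0.
  have [yY|yY] := boolP (y \in Y); first by exists 0.
  have [|a aY Ha] := IH (y |: Y); first by rewrite cardsU1 yY; lia.
  exists a => _; split=> // h sh; rewrite -(Ha h sh) node_polyU1 //.
  by congr (L _); rewrite -/N; ring.
have [c Hc] := fin_all_exists IH'.
have cin y : y \notin Y -> c y != y -> c y \in Y.
  by move=> yY ncy; have [] := Hc y yY; rewrite !inE (negPf ncy).
pose Z := [set y in ~: Y | c y == y].
have [Z_big|Z_small] := ltnP 2 #|Z|.
  (* At a fixed point [y] the relation is quadratic in [y], with coefficients that do not depend on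
     [y]; three roots annihilate them all. Adding [j] points to [Y] then gives a killed node
     polynomial of degree [m - 1]. *)
  have moments h : (size h <= j)%N -> L (N * h) = 0 /\ L (N * ('X * h)) = 0.
    move=> sh.
    have [||-> /eqP B0 _] // := @quadratic_eq0_on_set _ Z (L (N * h))
      (- 2%:R * L (N * ('X * h))) (L (N * ('X^2 * h))).
      move=> y; rewrite !inE => /andP[yY /eqP cy].
      have [_ /(_ h sh)] := Hc y yY; rewrite cy.
      rewrite (_ : N * _ = y ^+ 2 *: (N * h) - (2%:R * y) *: (N * ('X * h)) +
          N * ('X^2 * h)); last first.
        rewrite -!mul_polyC !(polyC_exp, polyCM) polyCMn; ring.
      by rewrite linearD linearB /= !LZ => <-; ring.
    split=> //; move: B0.
    by rewrite mulf_eq0 oppr_eq0 (negPf two_neq0) => /eqP.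
  have [W WY cW] : exists2 W : {set F}, W \subset ~: Y & #|W| = j.
    have : (j <= #|~: Y|)%N by lia.
    move=> lej; exists [set x in take j (enum (~: Y))].
      by apply/subsetP => x; rewrite inE => /mem_take; rewrite mem_enum.
    rewrite cardsE (card_uniqP _) ?take_uniq ?enum_uniq // size_takel //.
    by rewrite -cardE.
  have := @L_neq0 (W :|: Y).
  have dis : [disjoint W & Y] by rewrite disjoints_subset.
  rewrite cardsU (disjoint_setI0 dis) cards0 cW.
  have -> : node_poly (W :|: Y) = N * node_poly W.
    by rewrite mulrC -[RHS]bigU //; apply: eq_bigl => x; rewrite !inE.
  rewrite (annihilates_shift j_gt0 moments) ?eqxx ?size_node_poly ?cW //.
  by move=> contra; suff : false by []; apply: contra; rewrite eY; lia.
pose Z' := ~: Y :\: Z.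
have cZ' : (#|Y| < #|Z'|)%N.
  have := cardsID Z (~: Y); have := subset_leq_card (subsetIr (~: Y) Z).
  by rewrite -/Z'; lia.
have : ~~ dinjectiveb c (mem Z').
  apply: contraL cZ' => /dinjectiveP injc; rewrite -leqNgt -(card_in_imset injc).
  apply/subset_leq_card/subsetP => _ /imsetP[x xZ' ->].
  by move: xZ'; rewrite !inE andbC => /andP[xY]; rewrite xY; apply: cin.
case/dinjectivePn => x xZ' [y /andP[/= nyx yZ'] cxy].
have [xY ncx] : x \notin Y /\ c x != x.
  by move: xZ'; rewrite !inE andbC => /andP[xY]; rewrite xY.
have yY : y \notin Y by move: yZ'; rewrite !inE andbC => /andP[].
exists (c x); first exact: cin.
(* The relations at [x] and [y] differ only in one linear factor, so subtracting them leaves [x - y]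
   times the desired value. *)
have H0 h : (size h <= j)%N -> L (N * ('X - (c x)%:P) * h) = 0.
  move=> sh; have [_ /(_ h sh) Ex] := Hc x xY; have [_ /(_ h sh)] := Hc y yY.
  rewrite -cxy => Ey.
  have xy_neq0 : x - y != 0 by rewrite subr_eq0 eq_sym.
  apply/(mulfI xy_neq0); rewrite mulr0 -[RHS](subrr 0) -{1}Ey -Ex -linearB -LZ.
  by congr (L _); rewrite -mul_polyC; ring.
move=> h sh; rewrite mulrA; apply: (annihilates_shift j_gt0) sh => g sg.
split; first exact: H0.
have [_ /(_ g sg) Ex] := Hc x xY.
rewrite -Ex -[LHS]subr0 -(mulr0 x) -(H0 g sg) -LZ -linearB.
by congr (L _); rewrite -mul_polyC; ring.
Qed.

End LongCodes.

Lemma node_poly_in_kernel_long (F : finFieldType) (L : {scalar {poly F}})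
    (m : nat) :
  2%:R != 0 :> F -> (0 < m)%N -> (m.*2 <= #|F|.+1)%N ->
  exists2 X : {set F}, (m.-1 <= #|X| <= m)%N & L (node_poly X) = 0.
Proof.
move=> two_neq0 m_gt0 m_small.
have [/existsP[X /andP[cX /eqP LX]]|] :=
    boolP [exists X : {set F}, (m.-1 <= #|X| <= m)%N && (L (node_poly X) == 0)].
  by exists X.
rewrite negb_exists => /forallP H.
have L_neq0 (X : {set F}) : (m.-1 <= #|X| <= m)%N -> L (node_poly X) != 0.
  by move=> cX; have := H X; rewrite cX.
have N0 : node_poly set0 = 1 :> {poly F} by rewrite /node_poly big_set0.
(* The descent starts from sets of size [m - 2], so [m = 1] is treated directly: if [L 1] is
   nonzero, [L] kills ['X - L 'X / L 1]. *)
have [m1|m_neq1] := eqVneq m 1%N.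
  have L1 : L 1 != 0 by rewrite -N0; apply: L_neq0; rewrite cards0 m1.
  have := L_neq0 [set L 'X / L 1]; rewrite cards1 m1 => /(_ isT).
  rewrite /node_poly big_set1 -alg_polyC linearB scalarZ /= divfK //.
  by rewrite subrr eqxx.
have desc j : (j.+2 <= m)%N -> forall Y : {set F}, (#|Y| + j.+2 = m)%N ->
    exists2 a, a \in Y & forall h : {poly F}, (size h <= j.+2)%N ->
    L (node_poly Y * (('X - a%:P) * h)) = 0.
  elim: j => [_ Y|j IH ltj]; first exact: apolar_base.
  by apply: apolar_step => // Y cY; apply: IH; rewrite // ltnW.
have [||a] := desc (m - 2)%N _ set0; rewrite ?cards0 ?inE //; lia.
Qed.

(** * Short codes: the lemma of tangents and weights on subsets *)

Section ShortCodes.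

Variables (F : finFieldType) (k : nat) (phi : {set F} -> F).
Hypothesis k_gt1 : (1 < k)%N.
Hypothesis k_char : forall i, (0 < i <= k)%N -> i%:R != 0 :> F.
Hypothesis k_small : (k.*2 <= #|F|.+1)%N.
Hypothesis phi_neq0 : forall C : {set F}, (k <= #|C| <= k.+1)%N -> phi C != 0.
Hypothesis phi_sub : forall (T : {set F}) x y, #|T| = k.-1 ->
  x \notin T -> y \notin T -> x != y ->
  phi (x |: T) - phi (y |: T) = (x - y) * phi (x |: (y |: T)).

Implicit Types (T C G : {set F}).

Let phi_inj T : #|T| = k.-1 -> {in ~: T &, injective (fun x => phi (x |: T))}.
Proof.
move=> cT x y; rewrite !inE => xT yT /eqP; rewrite -subr_eq0.
apply: contraTeq => nxy; rewrite phi_sub // mulf_neq0 ?subr_eq0 ?phi_neq0 //.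
by rewrite !cardsU1 yT !inE (negPf xT) (negPf nxy) cT /=; lia.
Qed.

Let phi_card T x : #|T| = k.-1 -> x \notin T -> phi (x |: T) != 0.
Proof. by move=> cT xT; rewrite phi_neq0 // cardsU1 xT cT; lia. Qed.

(** It depends on [C] alone, not on a chosen [(k-1)]-subset of [C]; this symmetry is the content of
    the lemma of tangents. *)
Definition tangent_weight C := phi C * \prod_(y in ~: C) phi (y |: C).

(* The values missed by [x |-> phi (x |: T)] are the roots of the tangent
   function at [T]; it has degree [k - 2]. *)
Lemma tangent_function T : #|T| = k.-1 ->
  exists2 P : {poly F}, (size P < k)%N & forall x, x \notin T ->
    P.[phi (x |: T)] * tangent_weight (x |: T) = \prod_(t in T) (x - t).
Proof.
move=> cT; pose g x := phi (x |: T).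
pose V : {set F} := [set v | (v != 0) && (v \notin g @: ~: T)].
exists (node_poly V).
  rewrite size_node_poly.
  have E : ~: V = 0 |: g @: ~: T.
    by apply/setP => v; rewrite !inE negb_and !negbK.
  have n0 : 0 \notin g @: ~: T.
    apply/imsetP => -[x]; rewrite inE => xT /esym/eqP.
    by rewrite (negPf (phi_card cT xT)).
  have cTC : (#|T| + #|~: T| = #|F|)%N by rewrite cardsC.
  have : (#|V| + #|~: V| = #|F|)%N by rewrite cardsC.
  have cI : #|g @: ~: T| = #|~: T| by rewrite card_in_imset //; apply: phi_inj.
  rewrite E cardsU1 n0 cI; have arith a b c :
    (k.-1 + b = c -> a + (1 + b) = c -> a.+1 < k)%N by lia.
  by apply: arith; rewrite -cT.
move=> x xT; have xT' : x \in ~: T by rewrite inE.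
(* The values [v] other than [g x] are 0, the missed values in [V], and the values of [g] at the
   other points outside [T]. *)
have Dg : \prod_(v | v != g x) (g x - v) = 
    g x * (node_poly V).[g x] * \prod_(y in ~: T :\ x) (g x - g y).
  rewrite (bigD1 0) /=; last by rewrite eq_sym phi_card.
  rewrite subr0 -mulrA; congr (_ * _).
  rewrite (bigID (mem (g @: ~: T))) /= mulrC; congr (_ * _).
    rewrite horner_prod; apply: eq_big => [v|v _]; last by rewrite hornerXsubC.
    rewrite inE; case: (eqVneq v (g x)) => [->|_]; last by [].
    by rewrite imset_f ?andbF.
  rewrite -[RHS](big_imset (fun v => g x - v)); last first.
    by move=> y z /setD1P[_ yT] /setD1P[_ zT]; apply: phi_inj.
  apply: eq_bigl => v; apply/andP/imsetP => [[/andP[nv _] /imsetP[y yT Ev]]|].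
    exists y => //; rewrite in_setD1 yT andbT.
    by apply: contraNneq nv => <-; rewrite Ev.
  move=> [y /setD1P[nyx yT] ->]; split; last exact: imset_f.
  rewrite phi_card //; last by rewrite inE in yT.
  by rewrite andbT; apply: contraNneq nyx => /(phi_inj cT yT xT')->.
have Dx : \prod_(y | y != x) (x - y) =
    \prod_(t in T) (x - t) * \prod_(y in ~: T :\ x) (x - y).
  rewrite (bigID (mem T)) /=; congr (_ * _); apply: eq_bigl => y; rewrite ?inE //.
  by case: eqVneq => [->|]; rewrite ?(negPf xT).
have Dphi : \prod_(y in ~: T :\ x) (g x - g y) =
    \prod_(y in ~: T :\ x) (x - y) *
    \prod_(y in ~: (x |: T)) phi (y |: (x |: T)).
  rewrite setCU setIC -setDE -big_split; apply: eq_bigr => y /=.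
  rewrite !inE => /andP[nyx yT].
  by rewrite /g phi_sub // 1?eq_sym // setUCA.
(* The products of differences at [x] and at [g x] are both [-1], hence equal. *)
have := prod_sub_others x; rewrite -(prod_sub_others (g x)) Dg Dx Dphi.
rewrite /tangent_weight -/(g x) => E.
have D_neq0 : \prod_(y in ~: T :\ x) (x - y) != 0.
  by apply/prodf_neq0 => y; rewrite !inE subr_eq0 eq_sym => /andP[].
by apply: (mulIf D_neq0); rewrite E; ring.
Qed.

(** Chosen so that, for a fixed [(k-1)]-subset [T] of [G], the weights of the sets [e |: T] are
    proportional to the terms of Lagrange's formula for the tangent function at [T]. *)
Definition arc_weight G C :=
  (tangent_weight C * \prod_(z in G :\: C) phi (z |: C) *
   \prod_(c in C) \prod_(z in G :\: C) (c - z))^-1.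

Lemma arc_weight_sum G T : T \subset G -> #|T| = k.-1 -> #|G| = k.*2.-1 ->
  \sum_(e in G :\: T) arc_weight G (e |: T) = 0.
Proof.
move=> TG cT cG; have [P sP PE] := tangent_function cT.
set E := G :\: T.
have cE : #|E| = k.
  by rewrite cardsD (setIidPr TG) cT cG; lia.
have ET e : e \in E -> e \notin T by case/setDP.
have injE : {in E &, injective (fun x => phi (x |: T))}.
  by move=> x y /ET xT /ET yT; apply: phi_inj; rewrite ?inE.
have := lagrange_coef injE; rewrite cE => /(_ P (ltnW sP)).
(* There are [k] nodes while [P] has degree at most [k - 2], so the interpolated coefficient of
   index [k - 1] is 0. *)
rewrite nth_default; last by rewrite -ltnS prednK ?(ltnW k_gt1).
(* The proportionality factor, independent of [e]; the sign comes from turning [t - e] into [e - t]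
   for the [k - 1] elements of [T]. *)
pose K := (-1) ^+ k.-1 / \prod_(t in T) \prod_(z in E) (t - z).
move=> /esym/(congr1 ( *%R K)); rewrite mulr0 mulr_sumr => sum0; rewrite -[RHS]sum0.
apply: eq_bigr => e eE; have eT := ET e eE.
have Gdef : G :\: (e |: T) = E :\ e.
  by apply/setP => z; rewrite !inE negb_or andbA.
rewrite /arc_weight Gdef.
have -> : \prod_(z in E :\ e) (phi (e |: T) - phi (z |: T)) =
    \prod_(z in E :\ e) (e - z) * \prod_(z in E :\ e) phi (z |: (e |: T)).
  rewrite -big_split; apply: eq_bigr => z /setD1P[nze zE] /=.
  by rewrite phi_sub ?ET // 1?eq_sym // setUCA.
rewrite big_setU1 //=.
have K_e : \prod_(t in T) \prod_(z in E) (t - z) =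
    (-1) ^+ k.-1 * \prod_(t in T) (e - t) *
    \prod_(t in T) \prod_(z in E :\ e) (t - z).
  rewrite -cT -prodrN -big_split; apply: eq_bigr => t _ /=.
  by rewrite (big_setD1 e) //= opprB.
have := PE e eT; set w := tangent_weight _.
have T_neq0 : \prod_(t in T) (e - t) != 0.
  by apply/prodf_neq0 => t tT; rewrite subr_eq0; apply: contraNneq eT => ->.
move=> Pw.
have w_neq0 : w != 0 by apply: contraNneq T_neq0 => w0; rewrite -Pw w0 mulr0.
have P_eq : P.[phi (e |: T)] = \prod_(t in T) (e - t) / w by rewrite -Pw mulfK.
have s_neq0 : (-1) ^+ k.-1 != 0 :> F by rewrite signr_eq0.
rewrite P_eq /K K_e; clearbody w; rewrite !invfM.
move: T_neq0 s_neq0; set a := \prod_(t in T) (e - t); set s := (-1) ^+ _ => a0 s0.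
rewrite !mulrA (mulfV s0) mul1r.
set b := (\prod_(z in _) (e - z))^-1; set d := (\prod_(z in _) phi _)^-1.
set f := (\prod_(t in T) _)^-1.
transitivity ((a / a) * (w^-1 * b * d * f)); last by ring.
by rewrite mulfV // mul1r; ring.
Qed.

Lemma tangent_weight_neq0 C : #|C| = k -> tangent_weight C != 0.
Proof.
move=> cC; rewrite mulf_neq0 ?phi_neq0 ?cC ?leqnSn ?leqnn //.
apply/prodf_neq0 => y; rewrite inE => yC; apply: phi_neq0.
by rewrite cardsU1 yC cC; lia.
Qed.

Lemma no_short_arc : False.
Proof.
have [G cG] : exists G : {set F}, #|G| = k.*2.-1.
  have cF : (k.*2.-1 <= #|F|)%N by lia.
  exists [set x in take k.*2.-1 (enum F)].
  rewrite cardsE (card_uniqP _) ?take_uniq ?enum_uniq // size_takel //.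
  by rewrite -cardE.
have [C CG cC] : exists2 C : {set F}, C \subset G & #|C| = k.
  exists [set x in take k (enum G)].
    by apply/subsetP => x; rewrite inE => /mem_take; rewrite mem_enum.
  rewrite cardsE (card_uniqP _) ?take_uniq ?enum_uniq // size_takel //.
  by rewrite -cardE cG; lia.
have cG' : (#|G| < k.*2)%N by rewrite cG; lia.
have := inclusion_kernel (beta := arc_weight G) cG' k_char
   (fun T TG cT => arc_weight_sum TG cT cG) CG cC.
move/eqP; rewrite invr_eq0; apply/negP.
apply: mulf_neq0; first apply: mulf_neq0; first exact: tangent_weight_neq0.
  apply/prodf_neq0 => z /setDP[_ zC]; apply: phi_neq0.
  by rewrite cardsU1 zC cC; lia.
apply/prodf_neq0 => c cinC; apply/prodf_neq0 => z /setDP[_ zC].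
by rewrite subr_eq0; apply: contraNneq zC => <-.
Qed.

End ShortCodes.

(** Complements of sets of size [k] and [k + 1] have sizes [m] and [m - 1]. The relation required of
    [phi] is [L] applied to [('X - y) - ('X - x) = x - y] times the common factor. *)
Lemma node_poly_in_kernel_short (F : finFieldType) (L : {scalar {poly F}})
    (m k : nat) :
  (1 < k)%N -> (forall i, (0 < i <= k)%N -> i%:R != 0 :> F) ->
  (k.*2 <= #|F|.+1)%N -> (m + k = #|F|)%N -> (0 < m)%N ->
  exists2 X : {set F}, (m.-1 <= #|X| <= m)%N & L (node_poly X) = 0.
Proof.
move=> k_gt1 k_char k_small mk m_gt0.
have [/existsP[X /andP[cX /eqP LX]]|] :=
    boolP [exists X : {set F}, (m.-1 <= #|X| <= m)%N && (L (node_poly X) == 0)].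
  by exists X.
rewrite negb_exists => /forallP H; exfalso.
apply: (@no_short_arc F k (fun C => L (node_poly (~: C)))) => //.
  move=> C cC; have := H (~: C); rewrite (_ : (_ <= _ <= _)%N) //.
  have : (#|C| + #|~: C| = #|F|)%N by rewrite cardsC.
  by lia.
move=> T x y cT xT yT nxy.
pose R := ~: (x |: (y |: T)).
have xR : x \notin R by rewrite !inE eqxx.
have yR : y \notin R by rewrite !inE eqxx orbT.
have -> : ~: (x |: T) = y |: R.
  apply/setP => z; rewrite !inE; case: (eqVneq z y) => [->|]; rewrite ?orbF //.
  by rewrite eq_sym (negPf nxy) (negPf yT).
have -> : ~: (y |: T) = x |: R.
  apply/setP => z; rewrite !inE; case: (eqVneq z x) => [->|]; rewrite ?orbF //.
  by rewrite (negPf nxy) (negPf xT).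
rewrite !node_polyU1 // -/R -linearB -scalarZ; congr (L _).
by rewrite -mul_polyC; ring.
Qed.

(** * Parity checks of the projective Reed-Solomon code *)

Section Syndrome.

Variable F : finFieldType.
Implicit Types (u : F -> F) (v : F) (f h : {poly F}).

(** The last coordinate belongs to the point at infinity, where a polynomial of degree at most [m]
    takes its coefficient of index [m] as value. *)
Definition syndrome u v m h : F := \sum_x u x * h.[x] + v * h`_m.

Fact syndrome_is_scalar u v m : scalar (syndrome u v m).
Proof.
move=> a f g; rewrite /syndrome coefD coefZ mulrDr mulrDr mulr_sumr.
rewrite addrACA -big_split mulrCA; congr (_ + _ ); apply: eq_bigr => x _ /=.
by rewrite hornerD hornerZ mulrDr mulrCA.
Qed.

HB.instance Definition _ u v m :=
  GRing.isLinear.Build F {poly F} F *%R (syndrome u v m)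
    (syndrome_is_scalar u v m).

(** The sum is minus the coefficient of [f * h] at index [#|F| - 1 = (k - 1) + m]. Only the product
    of the two extreme coefficients contributes there, and the last coordinate cancels it. *)
Lemma syndrome_codeword f h m k : (m + k = #|F|)%N -> (0 < k)%N ->
  (size f <= k)%N -> (size h <= m.+1)%N ->
  syndrome (horner f) f`_(k.-1) m h = 0.
Proof.
move=> mk k_gt0 sf sh; rewrite /syndrome.
under eq_bigr do rewrite -hornerM.
have mk' : (k + m.+1 <= 1 + #|F|)%N by lia.
rewrite sum_horner; last first.
  apply: leq_trans (size_polyMleq _ _) _; rewrite -subn1 leq_subLR.
  exact: leq_trans (leq_add sf sh) mk'.
have lk : (k.-1 < (m + k).-1.+1)%N by lia.
rewrite -mk coefM (bigD1 (Ordinal lk)) //= big1 ?addr0 => [|[j ltj] nj].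
  by rewrite (_ : (_ - _)%N = m) ?addNr //; lia.
have {}nj : j != k.-1 by [].
have [lej|ltj'] := leqP k j.
  by rewrite [f`_j]nth_default ?mul0r // (leq_trans sf).
by rewrite [X in _ * X]nth_default ?mulr0 // (leq_trans sh) //=; lia.
Qed.

Lemma syndrome_eq0_near u v m k (X : {set F}) : (m + k = #|F|)%N ->
  (0 < m)%N -> (0 < k)%N -> (m.-1 <= #|X| <= m)%N ->
  syndrome u v m (node_poly X) = 0 ->
  exists2 f : {poly F}, (size f <= k)%N &
    (#|[set x | u x != f.[x]]| + (v != f`_(k.-1))%R <= m)%N.
Proof.
move=> mk m_gt0 k_gt0 cX LX.
have cXC : (#|X| + #|~: X| = #|F|)%N by rewrite cardsC.
have reduce f : (size f <= k)%N ->
    \sum_x (u x - f.[x]) * (node_poly X).[x] +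
    (v - f`_(k.-1)) * (node_poly X)`_m = 0.
  move=> sf; have := syndrome_codeword mk k_gt0 sf (h := node_poly X).
  rewrite size_node_poly => /(_ ltac:(lia)) E.
  transitivity (syndrome u v m (node_poly X) -
      syndrome (horner f) f`_(k.-1) m (node_poly X)); last by rewrite LX E subrr.
  rewrite /syndrome mulrBl opprD addrACA -sumrB; congr (_ + _).
  by apply: eq_bigr => x _; rewrite mulrBl.
have mismatch f : (forall x, x \notin X -> u x = f.[x]) ->
    (#|[set x | u x != f.[x]]| <= #|X|)%N.
  move=> uf; apply/subset_leq_card/subsetP => x; rewrite inE.
  by apply: contraNT => /uf ->.
(* If [X] has [m] elements, interpolate [u] at the [k] points outside [X]; as the node polynomial is
   monic of degree [m], the syndrome forces the last coordinate to agree. *)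
have [cXm|cXm] := eqVneq #|X| m.
  have [f sf [fE _]] := @lagrange_interpolation _ (~: X) id u (in2W (@inj_id _)).
  have uf x : x \notin X -> u x = f.[x] by move=> xX; rewrite fE ?inE.
  have {}sf : (size f <= k)%N by apply: leq_trans sf _; lia.
  exists f => //; have := reduce f sf.
  rewrite big1 => [|x _]; last first.
    by have [/node_poly_root->|/uf->] := boolP (x \in X); rewrite ?mulr0 // subrr mul0r.
  rewrite -[X in (node_poly _)`_X]cXm lead_node_poly mulr1 add0r => /eqP.
  by rewrite subr_eq0 => ->; rewrite addn0 -cXm mismatch.
(* Now [X] has [m - 1] elements and [k + 1] points lie outside. Interpolating at all but [s], the
   syndrome forces agreement at [s]; the last coordinate may be the [m]-th error. *)
have [s sX] : exists s, s \in ~: X by apply/card_gt0P; lia.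
have [f sf [fE _]] := @lagrange_interpolation _ (~: X :\ s) id u (in2W (@inj_id _)).
have {}sf : (size f <= k)%N.
  apply: leq_trans sf _; have := cardsD1 s (~: X); rewrite sX; lia.
exists f => //; have := reduce f sf.
rewrite [X in _ * X]nth_default ?mulr0 ?addr0 ?size_node_poly; last by lia.
rewrite (bigD1 s) //= big1 ?addr0 => [/eqP|x nxs]; last first.
  have [/node_poly_root->|xX] := boolP (x \in X); first by rewrite mulr0.
  by rewrite fE ?subrr ?mul0r // !inE nxs.
rewrite mulf_eq0 orbC (negPf (node_poly_neq0 _)) /=; last by rewrite inE in sX.
rewrite subr_eq0 => /eqP us.
have ufX : (#|[set x | u x != f.[x]]| <= #|X|)%N.
  apply: mismatch => x xX; have [->//|nxs] := eqVneq x s.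
  by rewrite fE // !inE nxs.
by apply: leq_trans (leq_add ufX (leq_b1 _)) _; lia.
Qed.

End Syndrome.

(** * Hamming distance from a word to the code *)

Section Words.

Variables (F : finFieldType) (q : nat) (alpha : 'I_q -> F) (beta : F -> 'I_q).
Hypotheses (alphaK : cancel alpha beta) (betaK : cancel beta alpha).

Lemma hamming_dist_ext_word (u : 'rV[F]_(q + 1)) f c :
  hamming_dist u (ext_word alpha f c) =
  (#|[set x | (u 0 (lshift 1 (beta x)) != f.[x])%R]| +
   (u 0 (rshift q ord0) != c)%R)%N.
Proof.
rewrite /hamming_dist -sum1_card big_mkcond big_split_ord /= big_ord1.
congr (_ + _)%N; last first.
  by rewrite inE /ext_word row_mxEr mxE; case: (_ == _).
rewrite -sum1_card [RHS]big_mkcond (reindex beta) /=; last first.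
  by exists alpha => x _; [exact: betaK|exact: alphaK].
apply: eq_bigr => x _.
by rewrite !inE /ext_word row_mxEl mxE betaK.
Qed.

Lemma dist_to_code_leq (n : nat) (u c : 'rV[F]_n) (C : {set 'rV[F]_n}) :
  c \in C -> (dist_to_code u C <= hamming_dist u c)%N.
Proof.
move=> cC; rewrite /dist_to_code -big_filter.
have: c \in [seq i <- index_enum _ | i \in C].
  by rewrite mem_filter cC mem_index_enum.
elim: [seq _ <- _ | _] => // b s IH; rewrite inE big_cons geq_min.
by case/predU1P => [->|/IH ->]; rewrite ?leqnn ?orbT.
Qed.

(** The condition [d <= n] accounts for the value [n] from which the minimum starts. *)
Lemma leq_dist_to_code (n d : nat) (u : 'rV[F]_n) (C : {set 'rV[F]_n}) :
  (d <= n)%N -> (forall c, c \in C -> (d <= hamming_dist u c)%N) ->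
  (d <= dist_to_code u C)%N.
Proof.
move=> dn H; rewrite /dist_to_code; elim/big_ind: _ => // x y dx dy.
by rewrite leq_min dx.
Qed.

End Words.

(** * Covering radius and deep holes *)

Theorem corollaryI7 (F : finFieldType) (q p k : nat) (alpha : 'I_q -> F)
    (hq : #|F| = q) (hodd : odd q) (hp : p \in [pchar F])
    (halpha : bijective alpha)
    (hk : (3 <= k + 1 <= p)%N \/
          [/\ (3 <= q - p + 1)%N, (q - p + 1 <= k + 1)%N & (k + 1 <= q - 2)%N]) :
  covering_radius (PRS alpha k) = (q - k)%N /\
  (forall (f : {poly F}) (v : F), size f = k.+1 ->
     deep_hole (ext_word alpha f v) (PRS alpha k)).
Proof.
have [beta alphaK betaK] := halpha.
have p_prime : prime p := pcharf_prime hp.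
have p_gt1 := prime_gt1 p_prime.
have /dvdnP[r qE] : (p %| q)%N by rewrite (dvdn_pcharf hp) -hq natr_card_finField.
have [r_odd p_odd] : odd r /\ odd p by apply/andP; rewrite -oddM -qE.
have r_gt0 : (0 < r)%N by case: (r) r_odd.
have two_neq0 : 2%:R != 0 :> F.
  by rewrite -(dvdn_pcharf hp) dvdn_prime2 //; apply: contraTneq p_odd => ->.
have ranges : [/\ (1 < k)%N, (k < q)%N & (k < p)%N \/ ((q - k).*2 <= q.+1)%N].
  have pq : (p <= q)%N by rewrite qE leq_pmull.
  case: hk => [hk1|[h1 h2 h3]]; first by split; [lia|lia|left; lia].
  (* Here [q - p >= 2] excludes [q = p], so the odd quotient [r] is at least 3; then [q - k <= p]
     yields [2 (q - k) <= q + 1]. *)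
  have r_neq1 : r != 1%N by apply: contraTneq h1 => r1; rewrite qE r1; lia.
  have pq3 : (3 * p <= q)%N by rewrite qE leq_mul2r; lia.
  by split; [lia|lia|right; lia].
have [k_gt1 kq krange] := ranges.
have kernel (L : {scalar {poly F}}) :
    exists2 X : {set F}, ((q - k).-1 <= #|X| <= q - k)%N & L (node_poly X) = 0.
  have [mid|mid] := leqP (q - k).*2 q.+1.
    by apply: node_poly_in_kernel_long; rewrite ?hq //; lia.
  apply: (@node_poly_in_kernel_short _ _ _ k); rewrite ?hq //; try lia.
  case: krange => [kp i /andP[i_gt0 ik]|]; last by lia.
  by rewrite -(dvdn_pcharf hp); apply/negP => /(dvdn_leq i_gt0); lia.
have upper u : (dist_to_code u (PRS alpha k) <= q - k)%N.
  have [X cX LX] := kernel (syndrome (fun x => u 0 (lshift 1 (beta x)))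
    (u 0 (rshift q ord0)) (q - k)).
  have [|||f sf uf] := syndrome_eq0_near _ _ _ cX LX (k := k); rewrite ?hq; try lia.
  apply: leq_trans uf; rewrite -(hamming_dist_ext_word alphaK betaK).
  apply: dist_to_code_leq; apply/imsetP.
  by exists (NPoly sf).
have lower (f : {poly F}) v : size f = k.+1 ->
    (q - k <= dist_to_code (ext_word alpha f v) (PRS alpha k))%N.
  move=> sf; apply: leq_dist_to_code => [|_ /imsetP[g _ ->]]; first by lia.
  (* Drop the last coordinate: [f - g] has degree exactly [k], so the words agree at no more than
     [k] field elements. *)
  rewrite (hamming_dist_ext_word alphaK betaK); apply: leq_trans (leq_addr _ _).
  have sg := size_npoly g; set d := f - g.
  have sd : size d = k.+1 by rewrite size_polyDl sf // size_polyN ltnS.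
  have d_neq0 : d != 0 by rewrite -size_poly_eq0 sd.
  set M := [set x | _].
  have : (size (enum (~: M)) < size d)%N.
    apply: max_poly_roots => //; last exact: enum_uniq.
    apply/allP => x; rewrite mem_enum !inE negbK row_mxEl mxE betaK.
    by rewrite rootE hornerD hornerN subr_eq0.
  rewrite sd -cardE; have := cardsC M; rewrite hq; lia.
have radius : covering_radius (PRS alpha k) = (q - k)%N.
  apply/eqP; rewrite eqn_leq; apply/andP; split; first by apply/bigmax_leqP.
  (* The word of ['X^k] extended by 0 shows that the radius is at least [q - k]. *)
  apply: leq_trans (lower 'X^k 0 (size_polyXn _ _)) _.
  exact: leq_bigmax.
split=> // f v sf; apply/eqP; rewrite radius eqn_leq upper.
exact: lower.
Qed.
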